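(* Let $a_1,\dots,a_m\in\mathbb{R}^d$, $D=(b_1,\dots,b_m)\in\mathbb{R}^m$, $f(x)=\max_{i=1,\dots,m}\{a_i^Tx+b_i\}$, let $\mathcal{P}\subseteq\mathbb{R}^d$ be a nonempty bounded convex polytope, and let $f_{\mathrm{opt}}=\min_{x\in\mathcal{P}}f(x)$. Let $\epsilon>0$, $b_{\max}>0$, $k\ge 1$, step sizes $\alpha_1,\dots,\alpha_k>0$ and $x^{(1)}\in\mathcal{P}$. Let $x^{(1)},x^{(2)},\dots$ be the iterates of the $\epsilon$-differentially private subgradient method run for $k$ iterations. Then $$\mathbb{E}\left[\min_{i=1,2,\dots,k}f(x^{(i)})-f_{\mathrm{opt}}\right]\le\frac{R^2+G^2\sum_{i=1}^k\alpha_i^2}{2\sum_{i=1}^k\alpha_i}+\bar\gamma(\epsilon/k),$$ where $R=\mathrm{diam}(\mathcal{P})$, $G=\max_{i=1,\dots,m}\|a_i\|_2$, and $\bar\gamma(z)=2b_{\max}(1+\log m)/z$.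
   Context: $\mathrm{diam}(\mathcal{P})=\max_{x,y\in\mathcal{P}}\|x-y\|_2$; $\log$ is the natural logarithm. Private subgradient with parameter $\epsilon'>0$ at a point $x_0$: let $u_{\mathrm{sub}}(i;x_0)=a_i^Tx_0+b_i$ for $i\in\{1,\dots,m\}$; draw a random index $i^*\in\{1,\dots,m\}$ with $\mathbb{P}(i^*=i)\propto\exp(\epsilon' u_{\mathrm{sub}}(i;x_0)/(2b_{\max}))$; output $a_{i^*}$. The $\epsilon$-differentially private subgradient method with $k$ iterations: starting from the deterministic point $x^{(1)}\in\mathcal{P}$, for $i=1,\dots,k$ let $g^{(i)}$ be a private subgradient with parameter $\epsilon'=\epsilon/k$ at the point $x^{(i)}$, drawn with fresh independent randomness (conditionally on the past, its law depends only on $x^{(i)}$), and set $x^{(i+1)}=x^{(i)}-\alpha_i g^{(i)}$ (no projection onto $\mathcal{P}$ is performed). *)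

(* Defs.v *)
From mathcomp Require Import all_boot all_order all_algebra.
From mathcomp Require Import all_classical all_reals all_analysis.

Set Implicit Arguments.
Unset Strict Implicit.
Unset Printing Implicit Defensive.
Import Order.TTheory GRing.Theory Num.Theory.

Local Open Scope classical_set_scope.
Local Open Scope ring_scope.

Section Defs.
Context {R : realType}.

Definition dotv (d : nat) (x y : 'cV[R]_d) : R := (x^T *m y) 0 0.

(* The library norm on matrices is the sup norm, hence this definition. *)
Definition norm2 (d : nat) (x : 'cV[R]_d) : R := Num.sqrt (dotv x x).

(* Index types are 'I_n.+1: a maximum is taken over a nonempty family. *)
Definition finmax (n : nat) (F : 'I_n.+1 -> R) : R :=
  \big[Num.max/F ord0]_(i < n.+1) F i.

(* Minimum of F 0, ..., F (k - 1), for 0 < k. *)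
Definition seqmin (k : nat) (F : nat -> R) : R :=
  \big[Num.min/F 0%N]_(i < k) F i.

Definition bounded_polytope (d : nat) (Q : set 'cV[R]_d) : Prop :=
  (exists (p : nat) (C : 'M[R]_(p, d)) (c : 'cV[R]_p),
      Q = [set x | forall i, (C *m x) i 0 <= c i 0]) /\
  (exists M : R, forall x, Q x -> norm2 x <= M).

(* On a nonempty bounded polytope, which is compact, this supremum is a
   maximum, and the infimum in fopt below is a minimum. *)
Definition diam (d : nat) (Q : set 'cV[R]_d) : R :=
  sup [set norm2 (xy.1 - xy.2) | xy in Q `*` Q].

Section Objective.
Context {d m : nat} (a : 'I_m.+1 -> 'cV[R]_d) (b : 'I_m.+1 -> R).

Definition u_sub (i : 'I_m.+1) (x0 : 'cV[R]_d) : R := dotv (a i) x0 + b i.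

Definition pwmax (x : 'cV[R]_d) : R := finmax (fun i => u_sub i x).

Definition fopt (Q : set 'cV[R]_d) : R := inf (pwmax @` Q).

(* Probability that the private subgradient at x0 with parameter eps' draws
   the index i. *)
Definition private_index_prob (bmax eps' : R) (x0 : 'cV[R]_d) (i : 'I_m.+1)
    : R :=
  expR (eps' * u_sub i x0 / (2 * bmax)) /
  \sum_(j < m.+1) expR (eps' * u_sub j x0 / (2 * bmax)).

End Objective.

(* Counting starts at 0: alpha i, istar i and x i stand for alpha_{i+1},
   the index drawn at iteration i+1, and x^{(i+1)}; the output of iteration
   i+1 is g^{(i+1)} = a (istar i w).  The last clause is the conditional law of
   the index given the past draws: these are finitely valued, so it is enough
   to condition on the event that they coincide with those of w, and x i is
   constant and equal to x i w on this event. *)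
Definition private_subgradient_method (disp : measure_display)
    (T : measurableType disp) (P : probability T R) (d m : nat)
    (a : 'I_m.+1 -> 'cV[R]_d) (b : 'I_m.+1 -> R) (bmax eps : R) (k : nat)
    (alpha : nat -> R) (x1 : 'cV[R]_d)
    (istar : nat -> T -> 'I_m.+1) (x : nat -> T -> 'cV[R]_d) : Prop :=
  [/\ forall i j, (i < k)%N -> measurable [set w | istar i w = j],
      forall w, x 0%N w = x1,
      forall i w, (i < k)%N -> x i.+1 w = x i w - alpha i *: a (istar i w)
    & forall i j w, (i < k)%N ->
      let past := [set w' | forall l, (l < i)%N -> istar l w' = istar l w] in
      P (past `&` [set w' | istar i w' = j]) =
      (P past * (private_index_prob a b bmax (eps / k%:R) (x i w) j)%:E)%E].

(* n is the number of affine pieces. *)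
Definition gamma_bar (bmax : R) (n : nat) (z : R) : R :=
  2 * bmax * (1 + ln n%:R) / z.

End Defs.

(* Main.v *)
Require Import Defs.
From mathcomp Require Import all_boot all_order all_algebra.
From mathcomp Require Import all_classical all_reals all_analysis.
From mathcomp Require Import ring lra.
Import Order.TTheory GRing.Theory Num.Theory.
Local Open Scope classical_set_scope.
Local Open Scope ring_scope.

(* A drawn index j is only an approximate maximiser at the current iterate z, but
   its affine piece lies below f everywhere, so the usual telescoping of
   |z - y|^2 bounds min f - f(y), for every sample path and every y in P, by the
   deterministic rate plus the weighted average of the gaps
   f(z) - (a_j^T z + b_j).  Given the past, the expected gap of the exponential
   weights is at most 2 bmax (log m) / eps': with t the gap times
   lam = eps' / (2 bmax), average t <= log m - 1 + exp t / m over the drawn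
   index.  The past takes finitely many values, so all expectations are finite
   sums. *)

(** * Extrema and sums over finite index ranges *)

Section FiniteFamilies.
Context {R : realType}.

Lemma le_finmax {n : nat} (F : 'I_n.+1 -> R) i : F i <= finmax F.
Proof. exact: le_bigmax. Qed.

Lemma finmax_le {n : nat} (F : 'I_n.+1 -> R) c :
  (forall i, F i <= c) -> finmax F <= c.
Proof. by move=> Fc; apply: bigmax_le. Qed.

Lemma seqmin_le {k : nat} (F : nat -> R) i : (i < k)%N -> seqmin k F <= F i.
Proof.
by move=> ik; have := bigmin_le (F 0%N) (Ordinal ik) (fun i : 'I_k => F i).
Qed.

Lemma sum_ord_gt0 (k : nat) (F : nat -> R) : (0 < k)%N ->
  (forall i, (i < k)%N -> 0 < F i) -> 0 < \sum_(i < k) F i.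
Proof.
case: k => // k _ F0; rewrite big_ord_recl ltr_pwDl ?F0// sumr_ge0// => i _.
exact/ltW/F0/(ltn_ord (lift ord0 i)).
Qed.

End FiniteFamilies.

(** * Euclidean inner product, norm and diameter *)

Section EuclideanSpace.
Context {R : realType} {d : nat}.
Implicit Types x y v : 'cV[R]_d.

Lemma dotvE x y : dotv x y = \sum_i x i 0 * y i 0.
Proof. by rewrite /dotv mxE; apply: eq_bigr => i _; rewrite mxE. Qed.

Lemma dotvC x y : dotv x y = dotv y x.
Proof. by rewrite !dotvE; apply: eq_bigr => i _; rewrite mulrC. Qed.

Lemma dotvDr x y v : dotv x (y + v) = dotv x y + dotv x v.
Proof. by rewrite /dotv mulmxDr mxE. Qed.

Lemma dotvZr (c : R) x y : dotv x (c *: y) = c * dotv x y.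
Proof. by rewrite /dotv -scalemxAr mxE. Qed.

Lemma dotvBr x y v : dotv x (y - v) = dotv x y - dotv x v.
Proof. by rewrite -scaleN1r dotvDr dotvZr mulN1r. Qed.

Lemma dotv_ge0 x : 0 <= dotv x x.
Proof. by rewrite dotvE; apply: sumr_ge0 => i _; rewrite -expr2 sqr_ge0. Qed.

Lemma norm2_ge0 x : 0 <= norm2 x.
Proof. exact: sqrtr_ge0. Qed.

Lemma norm2_sqr x : norm2 x ^+ 2 = dotv x x.
Proof. exact/sqr_sqrtr/dotv_ge0. Qed.

Lemma dotv_add_sqr x y :
  dotv (x + y) (x + y) = dotv x x + 2 * dotv x y + dotv y y.
Proof.
rewrite dotvDr (dotvC _ x) (dotvC _ y) !dotvDr (dotvC y x); ring.
Qed.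

Lemma dotv_sub_sqr x y :
  dotv (x - y) (x - y) = dotv x x - 2 * dotv x y + dotv y y.
Proof.
rewrite dotvBr (dotvC _ x) (dotvC _ y) !dotvBr (dotvC y x); ring.
Qed.

Lemma norm2_sub_le_diam {Q : set 'cV[R]_d} {x y} : bounded_polytope Q ->
  Q x -> Q y -> norm2 (x - y) <= diam Q.
Proof.
move=> [_ [M QM]] Qx Qy; apply: ub_le_sup; last by exists (x, y).
(* A [sup] dominates the members of a set only if that set is bounded above. The bound comes from
   the parallelogram law: [|u - v|^2 = 2|u|^2 + 2|v|^2 - |u + v|^2 <= 4 M^2]. *)
exists (Num.sqrt (4 * M ^+ 2)) => _ [[u v] [/= Qu Qv] <-].
have leM w : Q w -> dotv w w <= M ^+ 2.
  move=> Qw; rewrite -norm2_sqr lerXn2r ?nnegrE ?norm2_ge0 ?QM//.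
  exact: le_trans (norm2_ge0 _) (QM _ Qw).
rewrite /norm2 ler_wsqrtr// dotv_sub_sqr.
have := dotv_ge0 (u + v); rewrite dotv_add_sqr.
by have := leM _ Qu; have := leM _ Qv; lra.
Qed.

End EuclideanSpace.

(** * Exponential weights, and the subgradient method along one sample path *)

Section Objective.
Context {R : realType} {d m : nat} (a : 'I_m.+1 -> 'cV[R]_d) (b : 'I_m.+1 -> R).

Lemma private_index_prob_gap (bmax eps' : R) (x : 'cV[R]_d) :
  0 < bmax -> 0 < eps' ->
  \sum_j (pwmax a b x - u_sub a b j x) * private_index_prob a b bmax eps' x j
  <= gamma_bar bmax m.+1 eps'.
Proof.
move=> bmax0 eps0; set f := pwmax a b x; set M : R := m.+1%:R.
pose lam := eps' / (2 * bmax).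
have lam0 : 0 < lam by rewrite divr_gt0// mulr_gt0.
pose e j := expR (lam * u_sub a b j x); pose S := \sum_j e j.
have e0 j : 0 < e j by exact: expR_gt0.
have eS j : e j <= S.
  by rewrite /S (bigD1 j)//= lerDl sumr_ge0// => i _; exact/ltW/e0.
have S0 : 0 < S by exact: lt_le_trans (e0 ord0) (eS ord0).
have M0 : 0 < M by rewrite ltr0n.
(* Passing to logarithms turns this into a bound on a maximum, checked piece by piece without naming
   a maximiser. *)
have fS : expR (lam * f) <= S.
  rewrite -[leRHS]lnK ?posrE// ler_expR mulrC -ler_pdivlMr//.
  apply: finmax_le => j; rewrite ler_pdivlMr// mulrC -ler_expR lnK ?posrE//.
  exact: eS.
have probE j : private_index_prob a b bmax eps' x j = e j / S.
  rewrite /private_index_prob /S /e /lam; congr (expR _ / _).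
    by rewrite mulrAC.
  by apply: eq_bigr => i _; congr expR; rewrite mulrAC.
(* [1 + s <= expR s] at [s = lam * (f - u_j) - ln M] *)
have gap j : (f - u_sub a b j x) * e j <=
    ((ln M - 1) * e j + expR (lam * f) / M) / lam.
  rewrite ler_pdivlMr//.
  have := expR_ge1Dx (lam * f - lam * u_sub a b j x - ln M).
  rewrite !expRB lnK ?posrE// -/(e j).
  move/(ler_wpM2r (ltW (e0 j))).
  have -> : expR (lam * f) / e j / M * e j = expR (lam * f) / M.
    by field; rewrite !gt_eqF.
  by rewrite -lerBlDl; congr (_ <= _); ring.
have -> : gamma_bar bmax m.+1 eps' = (1 + ln M) / lam.
  by rewrite /gamma_bar /lam -/M; field; rewrite !gt_eqF.
under eq_bigr => j _ do rewrite probE mulrA.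
rewrite -mulr_suml ler_pdivrMr//.
(* Over the [M] indices the terms [expR (lam * f) / M] add up to [expR (lam * f) <= S], which the
   [- 1] in [ln M - 1] absorbs. *)
apply: le_trans (ler_sum _ (fun j _ => gap j)) _.
rewrite -mulr_suml big_split/= -mulr_sumr -/S sumr_const card_ord -mulr_natr -/M.
rewrite divfK ?gt_eqF// [leRHS]mulrAC ler_pM2r ?invr_gt0//.
rewrite !mulrDl mul1r mulN1r.
by move: (ln M * S) => L; lra.
Qed.

(* [dotv (a j) (z - y)] dominates [u_sub j z - f y] because the [j]-th affine
   piece lies below [f] at [y]. *)
Lemma subgradient_method_descent {k : nat} {alpha : nat -> R}
    {j : nat -> 'I_m.+1} {z : nat -> 'cV[R]_d} (y : 'cV[R]_d) :
  (forall i, (i < k)%N -> 0 < alpha i) ->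
  (forall i, (i < k)%N -> z i.+1 = z i - alpha i *: a (j i)) ->
  2 * \sum_(i < k) alpha i * (u_sub a b (j i) (z i) - pwmax a b y) <=
  norm2 (z 0%N - y) ^+ 2
  + finmax (fun i => norm2 (a i)) ^+ 2 * \sum_(i < k) alpha i ^+ 2.
Proof.
set G := finmax _ => alpha0 zS.
(* The squared distance to [y] stays on the left so that the induction telescopes; at [n = k] it is
   dropped as nonnegative. *)
suff : forall n, (n <= k)%N -> norm2 (z n - y) ^+ 2
    + 2 * \sum_(i < n) alpha i * (u_sub a b (j i) (z i) - pwmax a b y) <=
    norm2 (z 0%N - y) ^+ 2 + G ^+ 2 * \sum_(i < n) alpha i ^+ 2.
  by move=> /(_ k (leqnn k)); have := sqr_ge0 (norm2 (z k - y)); lra.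
elim=> [_|n IHn nk]; first by rewrite !big_ord0 !mulr0.
have {IHn} := IHn (ltnW nk); rewrite !big_ord_recr/= !norm2_sqr zS// addrAC.
rewrite (dotv_sub_sqr (z n - y)) dotvZr dotvZr (dotvC (alpha n *: _)) dotvZr.
have aG : dotv (a (j n)) (a (j n)) <= G ^+ 2.
  have aG := le_finmax (fun i => norm2 (a i)) (j n).
  rewrite -norm2_sqr lerXn2r ?nnegrE ?norm2_ge0//.
  exact: le_trans (norm2_ge0 _) aG.
have le_f : u_sub a b (j n) (z n) - pwmax a b y <= dotv (z n - y) (a (j n)).
  have := le_finmax (fun i => u_sub a b i y) (j n).
  by rewrite -/(pwmax a b y) /u_sub (dotvC (z n - y)) dotvBr; lra.
have := ler_wpM2l (ltW (alpha0 _ nk)) le_f.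
have := ler_wpM2l (sqr_ge0 (alpha n)) aG.
by lra.
Qed.

(** The smallest [f (z i)] is at most their [alpha]-weighted average, and replacing each [f (z i)]
    by the value of the drawn piece costs exactly the weighted gap. The descent bound divided by
    [2 A] controls what remains. *)
Lemma subgradient_method_regret (Q : set 'cV[R]_d) (k : nat)
    (alpha : nat -> R) (j : nat -> 'I_m.+1) (z : nat -> 'cV[R]_d) :
  bounded_polytope Q -> Q (z 0%N) -> (0 < k)%N ->
  (forall i, (i < k)%N -> 0 < alpha i) ->
  (forall i, (i < k)%N -> z i.+1 = z i - alpha i *: a (j i)) ->
  seqmin k (fun i => pwmax a b (z i)) - fopt a b Q <=
  (diam Q ^+ 2 + finmax (fun i => norm2 (a i)) ^+ 2
     * \sum_(i < k) alpha i ^+ 2) / (2 * \sum_(i < k) alpha i)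
  + \sum_(i < k) alpha i / (\sum_(i < k) alpha i)
      * (pwmax a b (z i) - u_sub a b (j i) (z i)).
Proof.
move=> Qpoly Qz k0 alpha0 zS; set A := \sum_(i < k) alpha i.
set mn := seqmin _ _; set C := _ + _ * _; set gap := \sum_(i < k) _ / A * _.
have A0 : 0 < A by exact: sum_ord_gt0.
(* With [fopt] alone on the right, the claim is that the left side is a lower bound of [f] on [Q],
   to be checked at each [y]. *)
rewrite lerBlDr addrC -lerBlDr.
apply: lb_le_inf; first by exists (pwmax a b (z 0%N)), (z 0%N).
move=> _ [y Qy <-].
have := subgradient_method_descent y alpha0 zS.
have : norm2 (z 0%N - y) ^+ 2 <= diam Q ^+ 2.
  have := norm2_sub_le_diam Qpoly Qz Qy => le_diam.
  rewrite lerXn2r ?nnegrE ?norm2_ge0//.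
  exact: le_trans (norm2_ge0 _) le_diam.
have gapE : A * gap =
    \sum_(i < k) alpha i * (pwmax a b (z i) - u_sub a b (j i) (z i)).
  rewrite /gap mulr_sumr; apply: eq_bigr => i _.
  by rewrite mulrA mulrCA divff ?gt_eqF// mulr1.
have mnA : A * mn <= \sum_(i < k) alpha i * pwmax a b (z i).
  rewrite /A mulr_suml ler_sum// => i _.
  rewrite ler_wpM2l ?(ltW (alpha0 _ _))//.
  exact: (seqmin_le (fun i => pwmax a b (z i))).
have splitE : \sum_(i < k) alpha i * (u_sub a b (j i) (z i) - pwmax a b y) =
    \sum_(i < k) alpha i * pwmax a b (z i) - A * gap - A * pwmax a b y.
  rewrite gapE {1}/A mulr_suml -!sumrB; apply: eq_bigr => i _; ring.
rewrite splitE => leD leC.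
rewrite lerBlDr -(ler_pM2l (mulr_gt0 (ltr0n R 2) A0)).
have -> : 2 * A * (pwmax a b y + (C / (2 * A) + gap)) =
    2 * (A * pwmax a b y) + C + 2 * (A * gap).
  by field; rewrite gt_eqF.
by rewrite -mulrA /C; lra.
Qed.

End Objective.

(** * Expectations of finitely valued random variables *)

Section FinitelyValued.
Context {R : realType} {disp : measure_display} {T : measurableType disp}.
Variable P : probability T R.

Section Fibers.
Context {I : finType} {h : T -> I}.
Hypothesis mh : forall c, measurable [set w | h w = c].

(** This form reduces integrability and integrals to indicators of the fibres of [h], so that [I]
    carries no sigma-algebra. *)
Lemma comp_sum_indic (F : I -> R) : (fun w => (F (h w))%:E) =
  (fun w => \sum_c (F c)%:E * (\1_[set w | h w = c] w)%:E)%E.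
Proof.
apply/funext => w; rewrite (bigD1 (h w))//= indicE mem_set// mule1.
rewrite big1 ?adde0// => c /eqP hc.
by rewrite indicE memNset ?mule0// => /= /esym.
Qed.

Lemma integrable_comp_finite (F : I -> R) :
  P.-integrable setT (fun w => (F (h w))%:E).
Proof.
rewrite comp_sum_indic; apply: integrable_sum => // c _.
exact/integrableZl/integrable_indic.
Qed.

Lemma integrable_factor_finite (f : T -> R) :
  (forall w w', h w = h w' -> f w = f w') ->
  P.-integrable setT (fun w => (f w)%:E).
Proof.
move=> fh.
(* [F] reads [f] at a chosen point of each fibre; the value 0 on empty fibres is a dummy. *)
pose F c := if pselect (exists w, h w = c) is left e then f (sval (cid e)) else 0.
rewrite (_ : (fun w => (f w)%:E) = (fun w => (F (h w))%:E)).
  exact: integrable_comp_finite.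
apply/funext => w; rewrite /F; case: pselect => [e|[]]; last by exists w.
by case: cid => w' /= /fh ->.
Qed.

Lemma integral_comp_finite (F : I -> R) :
  (\int[P]_w (F (h w))%:E = \sum_c (F c)%:E * P [set w | h w = c])%E.
Proof.
rewrite comp_sum_indic integral_sum//; last first.
  by move=> c; exact/integrableZl/integrable_indic.
apply: eq_bigr => c _; rewrite integralZl//; last exact: integrable_indic.
by rewrite integral_indic// setIT.
Qed.

End Fibers.

(* [q c] is the conditional law of [g] given [h = c]. *)
Lemma integral_conditional_le {I J : finType} (h : T -> I) (g : T -> J)
    (q F : I -> J -> R) (gam : R) :
  (forall c, measurable [set w | h w = c]) ->
  (forall j, measurable [set w | g w = j]) ->
  (forall w j, P ([set w' | h w' = h w] `&` [set w' | g w' = j]) =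
     P [set w' | h w' = h w] * (q (h w) j)%:E)%E ->
  (forall c, \sum_j F c j * q c j <= gam) ->
  (\int[P]_w (F (h w) (g w))%:E <= gam%:E)%E.
Proof.
move=> mh mg law Fq.
have mhg (cj : I * J) : measurable [set w | (h w, g w) = cj].
  have -> : [set w | (h w, g w) = cj] =
      [set w | h w = cj.1] `&` [set w | g w = cj.2].
    by case: cj => c j; apply/seteqP; split=> w /= [-> ->].
  exact: measurableI.
rewrite (integral_comp_finite mhg (fun cj => F cj.1 cj.2)).
have -> : (\sum_cj (F cj.1 cj.2)%:E * P [set w | (h w, g w) = cj] =
    \sum_c \sum_j (F c j)%:E * P [set w | (h w, g w) = (c, j)])%E.
  by rewrite pair_bigA/=; apply: eq_bigr => -[].
have row c : (\sum_j (F c j)%:E * P [set w | (h w, g w) = (c, j)] =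
    (\sum_j F c j * q c j)%:E * P [set w | h w = c])%E.
  (* The conditional law is given at sample points, so it says nothing about an empty fibre; there
     both sides vanish. *)
  have [[w <-]|hc] := pselect (exists w, h w = c); last first.
    have -> : [set w | h w = c] = set0.
      by apply/seteqP; split=> // w hw; apply: hc; exists w.
    rewrite measure0 mule0 big1// => j _.
    have -> : [set w | (h w, g w) = (c, j)] = set0.
      by apply/seteqP; split=> // w [hw _]; apply: hc; exists w.
    by rewrite measure0 mule0.
  have Pfin : P [set w' | h w' = h w] \is a fin_num by exact: fin_num_measure.
  rewrite -(fineK Pfin) -EFinM mulr_suml -sumEFin; apply: eq_bigr => j _.
  have -> : [set w' | (h w', g w') = (h w, j)] =
      [set w' | h w' = h w] `&` [set w' | g w' = j].
    by apply/seteqP; split=> w' /= [-> ->].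
  by rewrite law -(fineK Pfin) -!EFinM; congr (_%:E); ring.
under eq_bigr do rewrite row.
(* The fibres have total mass 1, so [gam] is its own average over them and the comparison can be
   made termwise. *)
have -> : gam%:E = (\sum_c gam%:E * P [set w | h w = c])%E.
  rewrite -(integral_comp_finite mh (fun=> gam)) integral_cst//=.
  by rewrite probability_setT mule1.
by apply: lee_sum => c _; rewrite lee_wpmul2r// lee_fin.
Qed.

End FinitelyValued.

(** * The past draws and the iterates they determine *)

Section History.
Context {R : realType} {disp : measure_display} {T : measurableType disp}.
Context {P : probability T R} {d m : nat}.
Context {a : 'I_m.+1 -> 'cV[R]_d} {b : 'I_m.+1 -> R} {bmax eps : R} {k : nat}.
Context {alpha : nat -> R} {x1 : 'cV[R]_d}.
Context {istar : nat -> T -> 'I_m.+1} {x : nat -> T -> 'cV[R]_d}.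
Hypothesis hx : private_subgradient_method P a b bmax eps k alpha x1 istar x.

(** A finite function, so that the past takes values in a [finType]. *)
Definition history (i : nat) (w : T) : {ffun 'I_i -> 'I_m.+1} :=
  [ffun l : 'I_i => istar l w].

Definition history_iterate (i : nat) (c : {ffun 'I_i -> 'I_m.+1}) : 'cV[R]_d :=
  x1 - \sum_(l < i) alpha l *: a (c l).

(** Unrolling the recursion shows that randomness enters an iterate only through the earlier draws;
    hence it is constant on each conditioning event. *)
Lemma iterate_history (i : nat) (w : T) : (i <= k)%N ->
  x i w = history_iterate i (history i w).
Proof.
have [_ x0 xS _] := hx; elim: i => [|i IHi] ik.
  by rewrite x0 /history_iterate big_ord0 subr0.
rewrite xS// IHi ?(ltnW ik)// /history_iterate big_ord_recr/= opprD addrA ffunE.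
by congr (_ - _ - _); apply: eq_bigr => l _; rewrite !ffunE.
Qed.

Lemma history_eqP (i : nat) (w w' : T) : history i w' = history i w <->
  (forall l, (l < i)%N -> istar l w' = istar l w).
Proof.
split=> [/ffunP eq_h l li|eq_h]; last by apply/ffunP => l; rewrite !ffunE eq_h.
by have := eq_h (Ordinal li); rewrite !ffunE.
Qed.

Lemma measurable_history (i : nat) (c : {ffun 'I_i -> 'I_m.+1}) : (i <= k)%N ->
  measurable [set w | history i w = c].
Proof.
move=> ik; have [mistar _ _ _] := hx.
have -> : [set w | history i w = c] =
    \big[setI/setT]_(l < i) [set w | istar l w = c l].
  rewrite -bigcap_seq; apply/seteqP; split=> w /=.
    by move=> <- l _ /=; rewrite ffunE.
  by move=> cw; apply/ffunP => l; rewrite ffunE; apply: cw => /=; rewrite mem_index_enum.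
by apply: bigsetI_measurable => l _; exact/mistar/(leq_trans (ltn_ord l) ik).
Qed.

(** A history extends all shorter ones, so the single finite type of length-[k] histories serves for
    every iterate and gap at once. *)
Lemma eq_iterate_history (i : nat) (w w' : T) : (i <= k)%N ->
  history k w = history k w' -> x i w = x i w'.
Proof.
move=> ik /history_eqP eq_h; rewrite !iterate_history//.
suff -> : history i w = history i w' by [].
by apply/history_eqP => l li; exact/eq_h/(leq_trans li).
Qed.

Definition draw_gap (i : nat) (w : T) : R :=
  pwmax a b (x i w) - u_sub a b (istar i w) (x i w).

Lemma integrable_draw_gap (i : nat) : (i < k)%N ->
  P.-integrable setT (fun w => (draw_gap i w)%:E).
Proof.
move=> ik.
apply: (integrable_factor_finite P (fun c => measurable_history k c (leqnn k))).
move=> w w' eq_h; rewrite /draw_gap (eq_iterate_history i w w') ?(ltnW ik)//.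
by move/history_eqP : eq_h => ->.
Qed.

(** Given the history, the iterate is fixed and the index follows the exponential weights there, so
    the gap bound applies to each conditional expectation. *)
Lemma integral_draw_gap_le (i : nat) : 0 < bmax -> 0 < eps -> (i < k)%N ->
  (\int[P]_w (draw_gap i w)%:E <= (gamma_bar bmax m.+1 (eps / k%:R))%:E)%E.
Proof.
move=> bmax0 eps0 ik; have [mistar _ _ law] := hx.
have eps'0 : 0 < eps / k%:R by rewrite divr_gt0// ltr0n (leq_ltn_trans _ ik).
pose F c j := pwmax a b (history_iterate i c) - u_sub a b j (history_iterate i c).
pose q c := private_index_prob a b bmax (eps / k%:R) (history_iterate i c).
rewrite (eq_integral (fun w => (F (history i w) (istar i w))%:E)); last first.
  by move=> w _; rewrite /draw_gap iterate_history// ltnW.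
apply: (integral_conditional_le P (history i) (istar i) q F).
- by move=> c; exact/measurable_history/ltnW.
- by move=> j; exact: mistar.
- move=> w j; rewrite /q -iterate_history ?(ltnW ik)//.
  (* The conditioning event of the method is a fibre of [history i]. *)
  rewrite (_ : [set w' | history i w' = history i w] =
    [set w' | forall l, (l < i)%N -> istar l w' = istar l w]) ?law//.
  by apply/seteqP; split=> w' /history_eqP.
- by move=> c; exact: private_index_prob_gap.
Qed.

End History.

(** * Integration of the pathwise bound *)

Theorem theorem24 (R : realType) (disp : measure_display)
  (T : measurableType disp) (P : probability T R) (d m : nat)
  (a : 'I_m.+1 -> 'cV[R]_d) (b : 'I_m.+1 -> R)
  (Q : set 'cV[R]_d) (hQ : bounded_polytope Q) (hQ0 : Q !=set0)
  (eps bmax : R) (heps : 0 < eps) (hbmax : 0 < bmax)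
  (k : nat) (hk : (1 <= k)%N)
  (alpha : nat -> R) (halpha : forall i, (i < k)%N -> 0 < alpha i)
  (x1 : 'cV[R]_d) (hx1 : Q x1)
  (istar : nat -> T -> 'I_m.+1) (x : nat -> T -> 'cV[R]_d)
  (hx : private_subgradient_method P a b bmax eps k alpha x1 istar x) :
  let r := diam Q in
  let G := finmax (fun i => norm2 (a i)) in
  ('E_P[(fun w => (seqmin k (fun i => pwmax a b (x i w)) - fopt a b Q)%R)] <=
   ((r ^+ 2 + G ^+ 2 * \sum_(i < k) alpha i ^+ 2) /
      (2 * \sum_(i < k) alpha i)
    + gamma_bar bmax m.+1 (eps / k%:R))%R%:E)%E.
Proof.
cbv zeta; set C := (_ / (2 * _))%R; set gam := gamma_bar _ _ _.
have [_ x0 xS _] := hx; set A := \sum_(i < k) alpha i in C *.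
pose gap := @draw_gap _ _ _ _ _ a b istar x.
have A0 : 0 < A by exact: sum_ord_gt0.
have igap (i : 'I_k) : P.-integrable setT
    (fun w => ((alpha i / A)%:E * (gap i w)%:E)%E).
  by apply: integrableZl => //; exact: (integrable_draw_gap hx).
have isum : P.-integrable setT
    (fun w => (\sum_(i < k) (alpha i / A)%:E * (gap i w)%:E)%E).
  exact: integrable_sum.
have iC : P.-integrable setT (cst C%:E) by exact: finite_measure_integrable_cst.
rewrite unlock.
apply: (@le_trans _ _
  (\int[P]_w (cst C%:E w + \sum_(i < k) (alpha i / A)%:E * (gap i w)%:E))%E).
  apply: le_integral => //; last 2 first.
  - exact: integrableD.
  - move=> w _; rewrite /= sumEFin -EFinD lee_fin.
    apply: (subgradient_method_regret a b Q k alpha (istar^~ w) (x^~ w)) => //.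
    + by rewrite x0.
    + by move=> i ik; exact: xS.
  apply: (integrable_factor_finite P
    (fun c => measurable_history hx k c (leqnn k))).
  move=> w w' eq_h; rewrite /seqmin; congr (_ - _).
  (* The initial value of the iterated minimum, at index 0, is rewritten apart from the terms. *)
  rewrite (eq_iterate_history hx 0 w w')//; apply: eq_bigr => i _.
  by rewrite (eq_iterate_history hx i w w')// ltnW.
rewrite integralD// integral_cst//= probability_setT mule1 EFinD leeD2l//.
rewrite integral_sum//.
apply: (@le_trans _ _ (\sum_(i < k) (alpha i / A * gam)%:E)%E).
  apply: lee_sum => i _; rewrite integralZl//; last exact: (integrable_draw_gap hx).
  rewrite [leRHS]EFinM lee_wpmul2l//.
    by rewrite lee_fin divr_ge0 ?(ltW (halpha _ _))// ltW.
  exact: (integral_draw_gap_le hx).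
(* The weights [alpha i / A] sum to 1. *)
by rewrite sumEFin lee_fin -mulr_suml -mulr_suml divff ?gt_eqF// mul1r.
Qed.
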